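(* Let $\mathcal{C}$ be a symmetric class of subsets of $\{1,\ldots,n\}$, all of the same cardinality $K\ge1$. If $\mathcal{A}$ is an arbitrary (nonempty) subclass of $\mathcal{C}$, then for all $\mu>0$, $$R^*_{\mathcal{A}}(\mu)\ \le\ R^*_{\mathcal{C}}(\mu).$$
   Context: Setting: for a class $\mathcal{L}$ of $|\mathcal{L}|\ge 1$ distinct subsets of $\{1,\ldots,n\}$, all of cardinality $K$, and $\mu>0$: under $\mathbb{P}_0$ the components of the random vector $\mathbf{X}=(X_1,\ldots,X_n)$ are independent standard normal; for $S\in\mathcal{L}$, under $\mathbb{P}_S$ the components are independent with $X_i\sim\mathcal{N}(\mu,1)$ for $i\in S$ and $X_i\sim\mathcal{N}(0,1)$ for $i\notin S$. The risk of a (measurable) test $f:\mathbb{R}^n\to\{0,1\}$ for the class $\mathcal{L}$ is $$R_{\mathcal{L}}(f)=\mathbb{P}_0\{f(\mathbf{X})=1\}+\frac1{|\mathcal{L}|}\sum_{S\in\mathcal{L}}\mathbb{P}_S\{f(\mathbf{X})=0\},$$ and $R^*_{\mathcal{L}}(\mu)$ is the minimum of $R_{\mathcal{L}}(f)$ over all tests $f$. Symmetric class: a minimizer of the risk $R_{\mathcal{C}}$ is the optimal test $$f^*_{\mathcal{C}}(\mathbf{x})=\mathbf{1}\left\{\frac1{|\mathcal{C}|}\sum_{S\in\mathcal{C}}\exp\Big(\mu\sum_{i\in S}x_i\Big)\ge\exp(K\mu^2/2)\right\}.$$ The class $\mathcal{C}$ is called symmetric if the value of $\mathbb{P}_T\{f^*_{\mathcal{C}}(\mathbf{X})=0\}$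 is the same for all $T\in\mathcal{C}$ (for every $\mu>0$). *)

(* Defs.v *)
From HB Require Import structures.
From mathcomp Require Import all_boot all_order all_algebra.
From mathcomp Require Import all_classical all_reals all_analysis.

Set Implicit Arguments.
Unset Strict Implicit.
Unset Printing Implicit Defensive.
Import Order.TTheory GRing.Theory Num.Theory.
Import numFieldNormedType.Exports.

Local Open Scope classical_set_scope.
Local Open Scope ring_scope.
Local Open Scope ereal_scope.

Section tuple_product.
Context d (T : measurableType d) (R : realType).

Definition cons_tuple n (x : T * n.-tuple T) : n.+1.-tuple T :=
  [tuple of x.1 :: x.2].

Lemma measurable_cons_tuple n :
  measurable_fun [set: T * n.-tuple T] (@cons_tuple n).
Proof. exact: measurable_cons. Qed.

HB.instance Definition _ n :=
  isMeasurableFun.Build _ _ _ _ (@cons_tuple n) (@measurable_cons_tuple n).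

(* The product measure of P 0, ..., P n.-1, that is the law of a vector with
   independent components of laws P 0, ..., P n.-1, see
   [tuple_prod_box]. *)
Fixpoint tuple_prod n : ('I_n -> probability T R) -> probability (n.-tuple T) R :=
  match n with
  | 0 => fun=> \d_([tuple] : 0.-tuple T)
  | m.+1 => fun P =>
      distribution (P ord0 \x tuple_prod (fun i => P (lift ord0 i)))
        (@cons_tuple m)
  end.

Lemma tuple_prod_box n (P : 'I_n -> probability T R) (B : 'I_n -> set T) :
  (forall i, measurable (B i)) ->
  tuple_prod P [set x | forall i, B i (tnth x i)] = \prod_(i < n) P i (B i).
Proof.
elim: n P B => [|n IH] P B mB /=.
  by rewrite big_ord0 diracE mem_set// => -[].
rewrite big_ord_recl -IH; last by move=> i; exact: mB.
rewrite -product_measure1E//; last first.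
  rewrite (_ : [set _ | _] =
    \bigcap_(i in [set: 'I_n]) ((fun x => tnth x i) @^-1` B (lift ord0 i))).
    apply: fin_bigcap_measurable => // i _.
    by rewrite -[X in measurable X]setTI; exact: measurable_tnth.
  by apply/seteqP; split => x /= h i; [move=> _|]; exact: h.
congr product_measure1; apply/seteqP; split => -[x t] /=.
  move=> h; split=> [|i /=]; first by have := h ord0; rewrite tnth0.
  by have := h (lift ord0 i); rewrite tnthS.
move=> [/= hx ht] i.
by case: (unliftP ord0 i) => [j ->|->]; rewrite ?tnthS// tnth0.
Qed.

End tuple_product.

Section detection.
Context (R : realType) (n : nat).
Implicit Types (mu : R) (S T : {set 'I_n}) (L C : {set {set 'I_n}}).

Local Notation Rn := (n.-tuple (measurableTypeR R)).

(* [law mu S] is P_S and [null_law] is P_0; the second parameter of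
   [normal_prob] is the standard deviation. *)
Definition law mu S : probability Rn R :=
  tuple_prod (fun i => normal_prob (if i \in S then mu else 0%R) 1%R).

Definition null_law : probability Rn R :=
  tuple_prod (fun=> normal_prob 0%R 1%R).

Definition risk L mu (f : Rn -> bool) : \bar R :=
  null_law [set x | f x = true] +
  (#|L|%:R^-1)%:E * \sum_(S in L) law mu S [set x | f x = false].

(* By the Neyman-Pearson argument this infimum over measurable tests is a
   minimum, attained at [optimal_test K L mu] when all S in L have size K. *)
Definition optimal_risk L mu : \bar R :=
  ereal_inf [set risk L mu f | f in [set f | measurable_fun setT f]].

Definition optimal_test (K : nat) C mu (x : Rn) : bool :=
  (expR (K%:R * mu ^+ 2 / 2) <=
   #|C|%:R^-1 * \sum_(S in C) expR (mu * \sum_(i in S) tnth x i))%R.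

Definition symmetric_class (K : nat) C : Prop :=
  forall mu, (0 < mu)%R -> forall S T, S \in C -> T \in C ->
    law mu S [set x | optimal_test K C mu x = false] =
    law mu T [set x | optimal_test K C mu x = false].

End detection.

(* Main.v *)
(* The optimal test for C has the same type II error under every S in C, so its
   risk for A is its risk for C. By the Neyman-Pearson argument the latter is
   minimal: P_S has density lr_S with respect to P_0, hence the risk of f is
   the integral under P_0 of [if f then 1 else mean lr_S], which is minimized
   pointwise by taking f = 1 exactly when 1 <= mean lr_S. *)
Require Import Defs.
From mathcomp Require Import all_boot all_order all_algebra.
From mathcomp Require Import all_classical all_reals all_analysis.
From mathcomp Require Import measurable_realfun ring.

Set Implicit Arguments.
Unset Strict Implicit.
Unset Printing Implicit Defensive.
Import Order.TTheory GRing.Theory Num.Theory.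
Import numFieldNormedType.Exports.
Import HBNNSimple.

Local Open Scope classical_set_scope.
Local Open Scope ring_scope.
Local Open Scope ereal_scope.

(** * Integration against a measure with a density *)

Section density.
Context d (T : measurableType d) (R : realType).
Variables (nu m : {measure set T -> \bar R}) (g : T -> R).
Hypotheses (mg : measurable_fun setT g) (g0 : forall x, (0 <= g x)%R).
Hypothesis nuE : forall B, measurable B -> nu B = \int[m]_(x in B) (g x)%:E.

(** Linearity over the finite range of [h] reduces the claim to the indicators of its level sets,
    where it is [nuE]. *)
Let integral_density_nnsfun (h : {nnsfun T >-> R}) :
  \int[nu]_x (h x)%:E = \int[m]_x ((h x)%:E * (g x)%:E).
Proof.
have mh r : measurable (h @^-1` [set r]) by exact: measurable_funPTI.
transitivity
    (\int[nu]_x (\sum_(r \in range h) (r * \1_(h @^-1` [set r]) x)%:E)).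
  by apply: eq_integral => t _; rewrite fsumEFin// -fimfunE.
rewrite ge0_integral_fsum//; last 2 first.
- by move=> r; apply/measurable_EFinP/measurable_funM => //;
    exact: measurable_indic.
- by move=> r x _; exact: nnfun_muleindic_ge0.
transitivity (\int[m]_x (\sum_(r \in range h)
    ((r * \1_(h @^-1` [set r]) x)%:E * (g x)%:E))); last first.
  apply: eq_integral => t _; rewrite -ge0_mule_fsuml.
    by rewrite fsumEFin// -fimfunE.
  by move=> r; exact: nnfun_muleindic_ge0.
rewrite ge0_integral_fsum//; last 2 first.
- move=> r; apply: emeasurable_funM; last exact/measurable_EFinP.
  by apply/measurable_EFinP/measurable_funM => //; exact: measurable_indic.
- by move=> r x _; rewrite mule_ge0 ?lee_fin//; exact: nnfun_muleindic_ge0.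
apply: eq_fsbigr => r /[!inE] -[t _ hr].
have r0 : (0 <= r)%R by rewrite -hr.
under eq_integral do rewrite EFinM.
under [RHS]eq_integral do rewrite EFinM -muleA.
rewrite !ge0_integralZl_EFin//; last 3 first.
- by move=> x _; rewrite mule_ge0// lee_fin.
- by apply: emeasurable_funM; apply/measurable_EFinP => //;
    exact: measurable_indic.
- by apply/measurable_EFinP; exact: measurable_indic.
rewrite integral_indic// setIT nuE// integral_mkcond; congr (_ * _).
by apply: eq_integral => x _; rewrite patchE indicE; case: ifPn => xh;
  rewrite ?mul1e ?mul0e.
Qed.

(** Monotone convergence, applied under [nu] and under [m] to simple functions increasing to [f]. *)
Lemma ge0_integral_density (f : T -> \bar R) :
  measurable_fun setT f -> (forall x, 0 <= f x) ->
  \int[nu]_x f x = \int[m]_x (f x * (g x)%:E).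
Proof.
move=> mf f0; pose h := nnsfun_approx measurableT mf.
have hf x : (h n x)%:E @[n --> \oo] --> f x.
  by apply: cvg_nnsfun_approx.
have ndh x a b : (a <= b)%N -> (h a x <= h b x)%R.
  by move=> ab; exact/lefP/nd_nnsfun_approx.
transitivity (limn (fun n => \int[nu]_x (h n x)%:E)).
  rewrite -monotone_convergence//.
  - by apply: eq_integral => x _; apply/esym/cvg_lim.
  - by move=> n; exact/measurable_EFinP.
  - by move=> n x _; rewrite lee_fin.
  - by move=> x _ a b ab; rewrite lee_fin ndh.
under eq_fun do rewrite integral_density_nnsfun.
rewrite -monotone_convergence//.
- by apply: eq_integral => x _; apply/cvg_lim => //; exact: cvgeZr.
- by move=> n; apply: emeasurable_funM; exact/measurable_EFinP.
- by move=> n x _; rewrite mule_ge0// lee_fin.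
- by move=> x _ a b ab; rewrite lee_wpmul2r ?lee_fin ?ndh.
Qed.

End density.

(** * Change of measure in a finite product *)

Lemma measurable_prod_tnth d (T : measurableType d) (R : realType) n
    (g : 'I_n -> T -> R) : (forall i, measurable_fun setT (g i)) ->
  measurable_fun [set: n.-tuple T] (fun x => \prod_(i < n) g i (tnth x i))%R.
Proof.
move=> mg; apply: measurable_prod => i _.
by apply: measurableT_comp => //; exact: measurable_tnth.
Qed.

(** Induction on [n] through Tonelli: the induction hypothesis changes the laws of the tail, then
    the assumption on component 0 changes the law of the head. *)
Lemma ge0_integral_tuple_prod d (T : measurableType d) (R : realType) n
    (P Q : 'I_n -> probability T R) (g : 'I_n -> T -> R) :
  (forall i, measurable_fun setT (g i)) ->
  (forall i x, (0 <= g i x)%R) ->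
  (forall i f, measurable_fun setT f -> (forall x, 0 <= f x) ->
    \int[Q i]_x f x = \int[P i]_x (f x * (g i x)%:E)) ->
  forall f : n.-tuple T -> \bar R,
  measurable_fun setT f -> (forall x, 0 <= f x) ->
  \int[tuple_prod Q]_x f x =
  \int[tuple_prod P]_x (f x * (\prod_(i < n) g i (tnth x i))%:E).
Proof.
elim: n P Q g => [|n IH] P Q g mg g0 QP f mf f0.
  by apply: eq_integral => x _; rewrite big_ord0 mule1.
pose G (t : n.-tuple T) := (\prod_(i < n) g (lift ord0 i) (tnth t i))%R.
have G0 t : (0 <= G t)%R by exact: prodr_ge0.
have mG : measurable_fun setT G.
  exact: (@measurable_prod_tnth _ _ _ _ (fun i => g (lift ord0 i))).
have mfc : measurable_fun setT (f \o @Defs.cons_tuple _ T n).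
  by apply: measurableT_comp => //; exact: measurable_cons_tuple.
have mfG : measurable_fun setT (fun z : T * n.-tuple T =>
    f (Defs.cons_tuple z) * (G z.2)%:E).
  apply: emeasurable_funM => //; apply/measurable_EFinP.
  exact: measurableT_comp.
have fG0 z : 0 <= f (Defs.cons_tuple z) * (G z.2)%:E.
  by rewrite mule_ge0// lee_fin.
have mgf : measurable_fun setT (fun z : T * n.-tuple T =>
    f (Defs.cons_tuple z) * (G z.2)%:E * (g ord0 z.1)%:E).
  apply: emeasurable_funM => //; apply/measurable_EFinP.
  exact: measurableT_comp.
rewrite /= !ge0_integral_distribution//; last 2 first.
- by apply: emeasurable_funM => //; apply/measurable_EFinP;
    exact: measurable_prod_tnth.
- by move=> x; rewrite mule_ge0// lee_fin prodr_ge0.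
rewrite fubini_tonelli1//; last by move=> z; exact: f0.
(* The head factor goes last, so that it can leave the inner integral over the tail. *)
rewrite [RHS](_ : _ = \int[P ord0 \x tuple_prod (fun i => P (lift ord0 i))]_z
    (f (Defs.cons_tuple z) * (G z.2)%:E * (g ord0 z.1)%:E)); last first.
  apply: eq_integral => -[x t] _ /=; rewrite big_ord_recl tnth0.
  under eq_bigr do rewrite tnthS.
  by rewrite -muleA -EFinM [(G t * _)%R]mulrC.
rewrite [RHS]fubini_tonelli1//; last by move=> z; rewrite mule_ge0// lee_fin.
rewrite /fubini_F.
transitivity (\int[Q ord0]_x \int[tuple_prod (fun i => P (lift ord0 i))]_t
    (f (Defs.cons_tuple (x, t)) * (G t)%:E)).
  apply: eq_integral => x _.
  apply: (IH (fun i => P (lift ord0 i)) _ (fun i => g (lift ord0 i))) => //.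
  - by move=> i; exact: QP.
  - exact: (measurableT_comp mfc (measurable_pair1 x)).
  - by move=> t; exact: f0.
(* The change of law for the head is applied to the inner integral, as a function of [x]. *)
rewrite (QP _ (fubini_F _ (fun z => f (Defs.cons_tuple z) * (G z.2)%:E)))//.
- apply: eq_integral => x _; rewrite -ge0_integralZr ?lee_fin//.
  exact: (measurableT_comp mfG (measurable_pair1 x)).
- exact: measurable_fun_fubini_tonelli_F.
- by move=> x; exact: integral_ge0.
Qed.

(** * Likelihood ratios of shifted Gaussian vectors *)

Section change_of_law.
Context (R : realType) (n : nat).

(** The exponential is the quotient of the two Lebesgue densities: the normalizing constants agree,
    and [-(x - a)^2/2 = -x^2/2 + (a x - a^2/2)]. *)
Lemma ge0_integral_normal_prob (a : R) (f : measurableTypeR R -> \bar R) :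
  measurable_fun setT f -> (forall x, 0 <= f x) ->
  \int[normal_prob a 1%R]_x f x =
  \int[normal_prob 0%R 1%R]_x (f x * (expR (a * x - a ^+ 2 / 2))%:E).
Proof.
move=> mf f0.
have me : measurable_fun [set: measurableTypeR R]
    (fun x : R => expR (a * x - a ^+ 2 / 2)).
  apply: measurableT_comp => //; exact: measurable_funB.
have density b (h : measurableTypeR R -> \bar R) :
    measurable_fun setT h -> (forall x, 0 <= h x) ->
    \int[normal_prob b 1%R]_x h x =
    \int[lebesgue_measure]_x (h x * (normal_pdf b 1 x)%:E).
  apply: ge0_integral_density => [|x|B _].
  - exact: measurable_normal_pdf.
  - exact: normal_pdf_ge0.
  - by [].
rewrite density// density; first last.
- by move=> x; rewrite mule_ge0// lee_fin expR_ge0.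
- by apply: emeasurable_funM => //; exact/measurable_EFinP.
apply: eq_integral => x _; rewrite -muleA -EFinM; congr (_ * _%:E).
rewrite !normal_pdfE ?oner_neq0// mulrCA /normal_fun -expRD;
  congr (_ * expR _)%R.
by field.
Qed.

(** The density of [law mu S] with respect to [null_law], see [law_density]. *)
Definition likelihood_ratio mu (S : {set 'I_n}) (x : n.-tuple R) : R :=
  expR (mu * \sum_(i in S) tnth x i - #|S|%:R * mu ^+ 2 / 2).

Local Notation Rn := (n.-tuple (measurableTypeR R)).

Lemma measurable_likelihood_ratio mu S :
  measurable_fun [set: Rn] (likelihood_ratio mu S).
Proof.
apply: measurableT_comp => //; apply: measurable_funB => //.
(* Enumerating [S] gives a sum over a list, the form that [measurable_sum] handles. *)
apply: measurable_funM => //; under eq_fun do rewrite -big_enum.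
by apply: measurable_sum => i; exact: measurable_tnth.
Qed.

(** Components outside [S] have mean 0 and contribute the factor [expR 0 = 1]. *)
Lemma likelihood_ratio_prod mu (S : {set 'I_n}) (x : n.-tuple R) :
  let a i := if i \in S then mu else 0%R in
  likelihood_ratio mu S x =
  (\prod_(i < n) expR (a i * tnth x i - a i ^+ 2 / 2))%R.
Proof.
move=> a; rewrite /likelihood_ratio -expR_sum; congr expR.
rewrite sumrB; congr (_ - _)%R.
  rewrite mulr_sumr [LHS]big_mkcond/=; apply: eq_bigr => i _.
  by rewrite /a; case: ifP; rewrite ?mul0r.
rewrite [RHS](eq_bigr (fun i => if i \in S then mu ^+ 2 / 2 else 0)%R).
  rewrite -big_mkcond/= sumr_const -[RHS]mulr_natl.
  by rewrite [RHS]mulrA.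
by move=> i _; rewrite /a; case: ifP; rewrite ?expr0n ?mul0r.
Qed.

Lemma law_density mu S (B : set Rn) : measurable B ->
  law mu S B =
  \int[@null_law R n]_x ((\1_B x)%:E * (likelihood_ratio mu S x)%:E).
Proof.
move=> mB; pose a i : R := if i \in S then mu else 0%R.
transitivity (\int[law mu S]_x (\1_B x)%:E);
  first by rewrite integral_indic// setIT.
apply: etrans; first apply: (@ge0_integral_tuple_prod _ _ _ _
  (fun=> normal_prob 0%R 1%R) (fun i => normal_prob (a i) 1%R)
  (fun i x => expR (a i * x - a i ^+ 2 / 2))).
- by move=> i; apply: measurableT_comp => //; exact: measurable_funB.
- by move=> i x; exact: expR_ge0.
- by move=> i f mf f0; exact: ge0_integral_normal_prob.
- exact/measurable_EFinP/measurable_indic.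
- by move=> x; rewrite lee_fin.
by apply: eq_integral => x _; rewrite likelihood_ratio_prod.
Qed.

End change_of_law.

(** * Optimality of the likelihood ratio test *)

Section neyman_pearson.
Context (R : realType) (n : nat).
Local Notation Rn := (n.-tuple (measurableTypeR R)).
Implicit Types (L C : {set {set 'I_n}}) (mu : R).

Definition mean_likelihood_ratio L mu (x : n.-tuple R) : R :=
  (#|L|%:R^-1 * \sum_(S in L) likelihood_ratio mu S x)%R.

Lemma measurable_mean_likelihood_ratio L mu :
  measurable_fun [set: Rn] (mean_likelihood_ratio L mu).
Proof.
apply: measurable_funM => //; under eq_fun do rewrite -big_enum.
by apply: measurable_sum => S; exact: measurable_likelihood_ratio.
Qed.

Lemma mean_likelihood_ratio_ge0 L mu x : (0 <= mean_likelihood_ratio L mu x)%R.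
Proof. by rewrite mulr_ge0 ?invr_ge0// sumr_ge0// => S _; exact: expR_ge0. Qed.

Lemma risk_integral L mu (f : Rn -> bool) : measurable_fun setT f ->
  risk L mu f = \int[@null_law R n]_x
    (if f x then 1%R else mean_likelihood_ratio L mu x)%:E.
Proof.
move=> mf; pose B b := f @^-1` [set b].
have mB b : measurable (B b) by rewrite -[B b]setTI; exact: mf.
have mlr S : measurable_fun [set: Rn]
    (fun x => (\1_(B false) x)%:E * (likelihood_ratio mu S x)%:E).
  apply: emeasurable_funM; apply/measurable_EFinP;
    first exact: measurable_indic.
  exact: measurable_likelihood_ratio.
have lr0 S x : 0 <= (\1_(B false) x)%:E * (likelihood_ratio mu S x)%:E.
  by rewrite mule_ge0// lee_fin// expR_ge0.
rewrite /risk (_ : [set x | f x = true] = B true)//.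
rewrite (eq_bigr (fun S => \int[@null_law R n]_x
    ((\1_(B false) x)%:E * (likelihood_ratio mu S x)%:E))); last first.
  by move=> S _; exact: (law_density _ _ (mB false)).
rewrite -big_enum -ge0_integral_sum//.
rewrite -ge0_integralZl_EFin ?invr_ge0//; last 2 first.
- by move=> x _; exact: sume_ge0.
- by apply: emeasurable_sum => S; exact: mlr.
rewrite (_ : null_law R n (B true) = \int[@null_law R n]_x (\1_(B true) x)%:E);
  last by rewrite integral_indic// setIT.
rewrite -ge0_integralD//.
- apply: eq_integral => x _; rewrite big_enum/=.
  (* The events [f x = true] and [f x = false] are complementary, so at each [x] exactly one of the
     two error terms survives. *)
  have BE b : \1_(B b) x = (f x == b)%:R :> R.
    by rewrite indicE; congr (nat_of_bool _)%:R; apply/idP/eqP; rewrite inE.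
  under eq_bigr do rewrite BE -EFinM.
  rewrite BE sumEFin -EFinM -EFinD -mulr_sumr /mean_likelihood_ratio.
  by case: (f x); rewrite ?mul0r ?mulr0 ?addr0 ?add0r ?mul1r.
- exact/measurable_EFinP/measurable_indic.
- by move=> x _; rewrite mule_ge0 ?lee_fin ?invr_ge0// sume_ge0.
- apply: emeasurable_funM => //; apply: emeasurable_sum => S; exact: mlr.
Qed.

(** With a common cardinality [K], the factor [expR (- (K mu^2 / 2))] comes out of the mean, which
    turns the threshold into 1. *)
Lemma optimal_testE (K : nat) C mu x : (forall S, S \in C -> #|S| = K) ->
  optimal_test K C mu x = (1 <= mean_likelihood_ratio C mu x)%R.
Proof.
move=> cardC.
have -> : mean_likelihood_ratio C mu x = ((expR (K%:R * mu ^+ 2 / 2))^-1 *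
    (#|C|%:R^-1 * \sum_(S in C) expR (mu * \sum_(i in S) tnth x i)))%R.
  rewrite /mean_likelihood_ratio [RHS]mulrCA; congr (_ * _)%R.
  rewrite mulr_sumr; apply: eq_bigr => S SC.
  by rewrite /likelihood_ratio cardC// expRD expRN mulrC.
by rewrite ler_pdivlMl ?expR_gt0// mulr1.
Qed.

Lemma measurable_optimal_test (K : nat) C mu :
  measurable_fun [set: Rn] (optimal_test K C mu).
Proof.
apply: measurable_fun_ler => //; apply: measurable_funM => //.
under eq_fun do rewrite -big_enum.
apply: measurable_sum => S; apply: measurableT_comp => //.
apply: measurable_funM => //; under eq_fun do rewrite -big_enum.
by apply: measurable_sum => i; exact: measurable_tnth.
Qed.

Lemma risk_optimal_test_le (K : nat) C mu (f : Rn -> bool) :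
  (forall S, S \in C -> #|S| = K) -> measurable_fun setT f ->
  risk C mu (optimal_test K C mu) <= risk C mu f.
Proof.
move=> cardC mf; have mif (g : Rn -> bool) : measurable_fun setT g ->
    measurable_fun setT
      (fun x => (if g x then 1%R else mean_likelihood_ratio C mu x)%:E).
  move=> mg; apply/measurable_EFinP/measurable_fun_ifT => //.
  exact: measurable_mean_likelihood_ratio.
have if0 (g : Rn -> bool) x :
    0 <= (if g x then 1%R else mean_likelihood_ratio C mu x)%:E.
  by case: ifP; rewrite lee_fin// mean_likelihood_ratio_ge0.
rewrite !risk_integral//; last exact: measurable_optimal_test.
apply: ge0_le_integral => //.
- by apply: mif; exact: measurable_optimal_test.
- exact: mif.
(* The optimal test selects the minimum of 1 and the mean likelihood ratio, while [f] selects one of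
   these two values. *)
- move=> x _; rewrite lee_fin optimal_testE//.
  by case: ifPn => h; case: ifPn => // _; rewrite ltW// ltNge.
Qed.

End neyman_pearson.

(** * Comparison of a subclass with the symmetric class *)

Theorem theorem5p1 (R : realType) (n K : nat) (hK : (0 < K)%N)
    (C : {set {set 'I_n}}) (cardC : forall S, S \in C -> #|S| = K)
    (symC : symmetric_class R K C)
    (A : {set {set 'I_n}}) (A_neq0 : A != finset.set0) (subAC : A \subset C)
    (mu : R) (mu_gt0 : (0 < mu)%R) :
  (optimal_risk A mu <= optimal_risk C mu)%E.
Proof.
have /set0Pn[T TA] := A_neq0.
have mtest := @measurable_optimal_test R n K C mu.
(* Finiteness allows the average of type II errors to be computed in [R]. *)
have finT : law mu T [set x | optimal_test K C mu x = false] \is a fin_num.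
  apply: fin_num_measure; rewrite -[X in measurable X]setTI.
  exact: (mtest measurableT [set false]).
(* By symmetry every type II error equals that under [T], so their average over [L] does not depend
   on [L]. This serves for both [A] and [C]. *)
have risk_const (L : {set {set 'I_n}}) : L \subset C -> T \in L ->
    risk L mu (optimal_test K C mu) =
    null_law R n [set x | optimal_test K C mu x = true] +
    law mu T [set x | optimal_test K C mu x = false].
  move=> /fintype.subsetP LC TL; rewrite /risk; congr (_ + _).
  rewrite (eq_bigr (fun=> law mu T [set x | optimal_test K C mu x = false])).
    rewrite -(fineK finT) sumEFin sumr_const -EFinM.
    rewrite -[(fine _ *+ _)%R]mulr_natl mulKf//.
    by rewrite pnatr_eq0 cards_eq0; apply/set0Pn; exists T.
  by move=> S SL; apply: symC => //; exact: LC.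
(* The infimum for [A] is bounded by the risk of the test that is optimal for [C]. *)
apply: (@le_trans _ _ (risk A mu (optimal_test K C mu))).
  by apply: ereal_inf_lbound; exists (optimal_test K C mu).
rewrite risk_const// -(risk_const C)//; last exact: (fintype.subsetP subAC).
apply: le_ereal_inf_tmp => _ [f mf <-].
exact: risk_optimal_test_le.
Qed.
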